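(* Given an infinite binary sequence $\{b_k\}_{k\ge 0}$, the sequences of polynomials \[ \left\{a\left(2^{m+1}n + \sum_{j=0}^{m} 2^j b_j\,;\,z\right)\right\}_{m\ge 0} \quad\text{for all fixed integers } n>0 \] converge to the same analytic function $f_{\{b_k\}}$ on the open unit disk.
   Context: A binary sequence is a sequence whose elements are only $0$'s and $1$'s. The Stern polynomials $\{a(n;z)\}_{n\ge 0}$ are defined recursively by $a(0;z)=0$, $a(1;z)=1$, and, for $n\geq 1$, $a(2n;z)=a(n;z^2)$ and $a(2n+1;z)=z\,a(n;z^2)+a(n+1;z^2)$. The open unit disk is $\{z\in\mathbb{C}: |z|<1\}$. In each sequence of polynomials $n$ is held fixed and $m$ is the index tending to infinity; the limit function $f_{\{b_k\}}$ depends on the binary sequence $\{b_k\}$ but not on $n$. *)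

(* Defs.v *)
From HB Require Import structures.
From mathcomp Require Import all_boot all_order all_algebra.
From mathcomp Require Import zify.
From mathcomp Require Import all_classical all_reals.
From mathcomp Require Import topology normedtype sequences.

Set Implicit Arguments.
Unset Strict Implicit.
Unset Printing Implicit Defensive.

Import Order.TTheory GRing.Theory Num.Theory.
Import numFieldNormedType.Exports.

Local Open Scope classical_set_scope.
Local Open Scope ring_scope.

Section SternPolynomials.
Variable A : nzRingType.

(* The first argument only bounds the recursion depth; [k = n] is enough. *)
Fixpoint stern_rec (k n : nat) : {poly A} :=
  match k, n with
  | 0, _ | _, 0 => 0
  | _, 1 => 1
  | k'.+1, _ =>
      if odd n then 'X * (stern_rec k' n./2 \Po 'X^2)
                    + (stern_rec k' n./2.+1 \Po 'X^2)
      else stern_rec k' n./2 \Po 'X^2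
  end.

(* [a(n; z)] as a polynomial in [z]; its defining recursion is [stern0],
   [stern1], [stern_double] and [stern_doubleS]. *)
Definition stern (n : nat) : {poly A} := stern_rec n n.

Lemma stern_rec_stable k n : (n <= k)%N -> stern_rec k n = stern n.
Proof.
suff H N i j l : (l <= N)%N -> (l <= i)%N -> (l <= j)%N ->
    stern_rec i l = stern_rec j l by move=> nk; apply: (H n).
elim: N i j l => [|N IH] i j l; first by case: l => // _; case: i; case: j.
case: l => [|[|l]] lN; first by case: i; case: j.
  by case: i => // i; case: j.
case: i => // i; case: j => // j; rewrite !ltnS => li lj.
rewrite /= (IH i j l./2.+1) //; try lia.
by case: ifP => // /negPn lodd; rewrite (IH i j l./2.+2) //; lia.
Qed.

Lemma stern0 : stern 0 = 0.
Proof. by []. Qed.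

Lemma stern1 : stern 1 = 1.
Proof. by []. Qed.

Lemma stern_recE k n : (1 < n)%N -> stern_rec k.+1 n =
  if odd n then 'X * (stern_rec k n./2 \Po 'X^2)
                + (stern_rec k n./2.+1 \Po 'X^2)
  else stern_rec k n./2 \Po 'X^2.
Proof. by case: n => [|[]]. Qed.

Lemma stern_double n : (0 < n)%N -> stern n.*2 = stern n \Po 'X^2.
Proof.
move=> n0; rewrite -(@stern_rec_stable n.*2.+1) // stern_recE; last by lia.
by rewrite odd_double doubleK stern_rec_stable //; lia.
Qed.

Lemma stern_doubleS n : (0 < n)%N ->
  stern n.*2.+1 = 'X * (stern n \Po 'X^2) + (stern n.+1 \Po 'X^2).
Proof.
move=> n0; rewrite {1}/stern stern_recE; last by lia.
rewrite oddS odd_double /= uphalf_double.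
by rewrite !stern_rec_stable //; lia.
Qed.

End SternPolynomials.

Section ComplexFunctions.
Variable C : numFieldType. (* intended instance: [R[i]] with [R : realType] *)

Definition unit_disk : set C := [set z | `|z| < 1].

Definition analytic_on (D : set C) (f : C -> C) : Prop :=
  forall z0, D z0 -> exists c : nat -> C,
    \forall z \near z0, series (fun k => c k * (z - z0) ^+ k) @ \oo --> f z.

(* Locally uniform convergence on the open set [D], in the form of uniform
   convergence on every compact subset; it implies pointwise convergence. *)
Definition converges_on (D : set C) (F : nat -> C -> C) (f : C -> C) : Prop :=
  forall K : set C, compact K -> K `<=` D -> {uniform K, F @ \oo --> f}.

End ComplexFunctions.
Arguments unit_disk {C}.

(* Main.v *)
Require Import Defs.
From HB Require Import structures.
From mathcomp Require Import all_boot all_order all_algebra.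
From mathcomp Require Import complex.
From mathcomp Require Import all_classical all_reals.
From mathcomp Require Import topology normedtype sequences.
From mathcomp Require Import zify ring.

(** Both a(n; z^2) and a(n+1; z^2) contain only even powers of z, so in
    a(2n+1; z) = z a(n; z^2) + a(n+1; z^2) the two summands never meet in the
    same power.  Two facts about coefficients follow by halving the index.
    Every coefficient of a Stern polynomial is 0 or 1 ([stern_coef_bool]).
    Reading one binary digit of the index also halves the exponent, so the
    coefficients of exponent below 2^m depend only on the last m digits of the
    index, provided that the remaining leading part is positive
    ([stern_coef_low]): after m halvings only the constant coefficient is left,
    and that is 1 for every positive index.

    Hence, for a binary sequence b, the coefficient of z^k in the polynomials of
    the statement is constant once m >= k and is independent of n.  Call it c_k
    and let f be the sum of c_k z^k.  Since all coefficients involved have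
    modulus at most 1, on |z| <= r < 1 the polynomial of rank m differs from f
    only by tails of geometric series, by at most 3 r^m / (1 - r); this gives
    convergence uniform on compact sets ([power_series_converges]).

    That f is analytic at every point z0 of the disk, and not just at 0, is the
    classical recentering of a power series ([power_series_analytic]): expand
    each z^k around z0 by the binomial formula and exchange the two sums.  The
    exchange is made on partial sums, where it is a finite identity, and the
    error is controlled by the same expansion of (|z0| + rho)^k with
    |z0| + rho < 1 ([exprD_tail_le]).

    All limits come from one summation principle, that a complex series
    dominated by a geometric one converges at a geometric rate
    ([complex_geometric_sum]), obtained from the completeness of the reals
    applied to real and imaginary parts. *)

Set Implicit Arguments.
Unset Strict Implicit.
Unset Printing Implicit Defensive.

Import Order.TTheory GRing.Theory Num.Theory.
Import numFieldNormedType.Exports.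

Local Open Scope complex_scope.
Local Open Scope ring_scope.

(** * Coefficients of Stern polynomials *)

Section SternCoefficients.
Variable A : nzRingType.

Lemma coef_stern_double n k : (0 < n)%N ->
  (stern A n.*2)`_k = if odd k then 0 else (stern A n)`_k./2.
Proof.
by move=> n0; rewrite stern_double // coef_comp_poly_Xn // dvdn2 divn2; case: odd.
Qed.

Lemma coef_stern_doubleS n k : (0 < n)%N ->
  (stern A n.*2.+1)`_k = if odd k then (stern A n)`_k./2 else (stern A n.+1)`_k./2.
Proof.
move=> n0; rewrite stern_doubleS // coefD coefXM !coef_comp_poly_Xn // !dvdn2 !divn2.
case: k => [|k] /=; first by rewrite add0r.
case: (boolP (odd k)) => /= ok; first by rewrite add0r.
by rewrite addr0 uphalf_half (negbTE ok).
Qed.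

(** By [coef_stern_double] and [coef_stern_doubleS], every coefficient is either
    zero or a single coefficient at a smaller index: no additions occur. *)
Lemma stern_coef_bool n k : exists e : bool, (stern A n)`_k = e%:R.
Proof.
elim/ltn_ind: n k => n IH k.
have [n1|n1] := leqP n 1.
  case: n n1 {IH} => [|[|//]] _; first by exists false; rewrite coef0.
  by exists (k == 0)%N; rewrite stern1 coef1; case: (k == 0)%N.
rewrite -(odd_double_half n); case: (odd n) (odd_double_half n) => /= nE.
  rewrite add1n coef_stern_doubleS; last by lia.
  by case: odd; apply: IH; lia.
rewrite add0n coef_stern_double; last by lia.
by case: odd; [exists false | apply: IH; lia].
Qed.

(** Halving the index halves both the exponent k and the offset s.  An odd index calls
    for the two indices on either side of its half, hence the closed bound
    s <= 2^m: it is stable under s |-> s./2 + 1 for odd s, whereas s < 2^m is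
    not. *)
Lemma stern_coef_low m s n n' k : (0 < n)%N -> (0 < n')%N ->
  (s <= 2 ^ m)%N -> (k < 2 ^ m)%N ->
  (stern A (2 ^ m * n + s))`_k = (stern A (2 ^ m * n' + s))`_k.
Proof.
move=> n0 n'0; elim: m s k => [|m IH] s k.
  rewrite expn0 !mul1n ltnS leqn0 => _ /eqP ->.
  (* Only the constant coefficient is left, and it is 1 at positive indices. *)
  suff stern_coef0 l : (0 < l)%N -> (stern A l)`_0 = 1.
    by rewrite !stern_coef0 //; lia.
  elim/ltn_ind: l => l IH l0; have [l1|l1] := leqP l 1.
    by rewrite (_ : l = 1%N) ?stern1 ?coef1 //; lia.
  rewrite -(odd_double_half l); case: (odd l) (odd_double_half l) => /= lE.
    by rewrite add1n coef_stern_doubleS /=; [apply: IH; lia | lia].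
  by rewrite add0n coef_stern_double /=; [apply: IH; lia | lia].
have m0 : (0 < 2 ^ m)%N by rewrite expn_gt0.
have pos j : (0 < j)%N -> (0 < 2 ^ m * j)%N by move=> j0; rewrite muln_gt0 m0.
rewrite expnS => sm km.
have halve j : (2 * 2 ^ m * j + s = odd s + (2 ^ m * j + s./2).*2)%N.
  by rewrite -{1}(odd_double_half s) -mulnA; lia.
rewrite !halve.
have := pos _ n0; have := pos _ n'0.
case: (boolP (odd s)) => os p' p; rewrite ?add1n ?add0n.
  rewrite !coef_stern_doubleS; try lia.
  by case: odd; rewrite -?addnS; apply: IH; lia.
by rewrite !coef_stern_double; try lia; case: odd => //; apply: IH; lia.
Qed.

(** The digits of b from rank k + 1 on only contribute to a positive multiple of
    2^(k + 1), to which the coefficient of exponent k is blind; the reference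
    index on the right is the one with m = k and n = 1. *)
Lemma stern_coef_stable (b : nat -> bool) m n k : (0 < n)%N -> (k <= m)%N ->
  (stern A (2 ^ m.+1 * n + \sum_(0 <= j < m.+1) 2 ^ j * b j))`_k =
  (stern A (2 ^ k.+1 + \sum_(0 <= j < k.+1) 2 ^ j * b j))`_k.
Proof.
move=> n0 km.
have low l : (\sum_(0 <= j < l) 2 ^ j * b j <= 2 ^ l)%N.
  elim: l => [|l IH]; first by rewrite big_geq.
  by rewrite big_nat_recr //= expnS; move: (b l) IH => [] ?; lia.
(* Move the digits b (k + 1), ..., b m into the multiplier of 2 ^ k.+1. *)
have [n' n'0 ->] : exists2 n', (0 < n')%N &
    (2 ^ m.+1 * n + \sum_(0 <= j < m.+1) 2 ^ j * b j =
     2 ^ k.+1 * n' + \sum_(0 <= j < k.+1) 2 ^ j * b j)%N.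
  elim: m n n0 km => [|m IH] n n0 km.
    by exists n => //; move: km; rewrite leqn0 => /eqP ->.
  move: km; rewrite leq_eqVlt => /predU1P[->|km]; first by exists n.
  have [|n' n'0 n'E] := IH (2 * n + b m.+1)%N _ km; first by lia.
  exists n' => //; rewrite -n'E big_nat_recr //= [in LHS]expnS.
  by move: (2 ^ m.+1)%N (\sum_(_ <= _ < _) _)%N => x y; case: (b _); lia.
rewrite -[in RHS](muln1 (2 ^ k.+1)%N); apply: stern_coef_low => //.
by rewrite (leq_trans (ltn_expl k (ltnSn 1))) // leq_exp2l.
Qed.

End SternCoefficients.

(** * Series dominated by a geometric series *)

Section GeometricBounds.

Lemma geometric_tail_le (F : numFieldType) (r : F) m n : 0 <= r -> r < 1 ->
  \sum_(m <= k < n) r ^+ k <= r ^+ m / (1 - r).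
Proof.
move=> r0 r1; have r1' : 0 < 1 - r by rewrite subr_gt0.
have [mn|mn] := leqP m n; last first.
  by rewrite big_geq 1?ltnW // divr_ge0 ?exprn_ge0 // ltW.
rewrite ler_pdivlMr // mulr_suml.
rewrite (eq_bigr (fun k => - r ^+ k.+1 - - r ^+ k)); last first.
  by move=> k _; rewrite exprS; ring.
by rewrite telescope_sumr // opprK addrC gerBl exprn_ge0.
Qed.

(** Remainder of the binomial expansion of (x + y)^k after the powers of y below
    J.  In the expansion of (X + Y)^k each omitted term dominates its counterpart
    up to a factor q^j <= q^J.  The dependence of the bound on k is the full power
    (X + Y)^k, so it can be summed over k as soon as X + Y < 1. *)
Lemma exprD_tail_le (F : numFieldType) (x y X Y q : F) k J :
  `|x| <= X -> `|y| <= q * Y -> 0 <= Y -> 0 <= q -> q <= 1 ->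
  `|(x + y) ^+ k - \sum_(0 <= j < J) x ^+ (k - j) * y ^+ j *+ 'C(k, j)|
    <= q ^+ J * (X + Y) ^+ k.
Proof.
move=> xX yY Y0 q0 q1; have X0 := le_trans (normr_ge0 x) xX.
(* Summing beyond k adds only zero terms, as 'C(k, j) = 0 there, and avoids
   comparing J with k. *)
have binom (a b : F) : (a + b) ^+ k =
    \sum_(0 <= j < J + k.+1) a ^+ (k - j) * b ^+ j *+ 'C(k, j).
  rewrite exprDn -(big_mkord xpredT (fun j => a ^+ (k - j) * b ^+ j *+ 'C(k, j))).
  rewrite [RHS](@big_cat_nat _ _ _ k.+1) ?leq_addl //= [X in _ = _ + X]big1_seq.
    by rewrite addr0.
  by move=> j; rewrite mem_index_iota => /andP[_ /andP[kj _]]; rewrite bin_small.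
rewrite !binom [X in X - _](@big_cat_nat _ _ _ J) ?leq_addr //= addrAC subrr add0r.
apply: le_trans (ler_norm_sum _ _ _) _.
rewrite [X in _ <= _ * X](@big_cat_nat _ _ _ J) ?leq_addr //= mulrDr.
apply: ler_wpDl.
  rewrite mulr_ge0 ?exprn_ge0 // sumr_ge0 // => j _.
  by rewrite mulrn_wge0 // mulr_ge0 ?exprn_ge0.
rewrite mulr_sumr big_seq [leRHS]big_seq; apply: ler_sum => j.
rewrite mem_index_iota => /andP[Jj _].
rewrite normrMn normrM !normrX mulrnAr lerMn2r; apply/orP; right.
rewrite mulrCA ler_pM ?exprn_ge0 //; first by rewrite lerXn2r ?nnegrE.
apply: le_trans (_ : (q * Y) ^+ j <= _).
  by rewrite lerXn2r ?nnegrE // mulr_ge0.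
by rewrite exprMn ler_wpM2r ?exprn_ge0 // ler_wiXn2l.
Qed.

Lemma real_geometric_sum (R : realType) (u : nat -> R) (B r : R) :
  0 <= r -> r < 1 -> (forall k, `|u k| <= B * r ^+ k) ->
  exists l, forall K, `|l - series u K| <= B / (1 - r) * r ^+ K.
Proof.
move=> r0 r1 ur.
have B0 : 0 <= B by have := ur 0; rewrite expr0 mulr1; apply: le_trans.
have cu : cvgn (series u).
  apply: normed_cvg; apply: (@series_le_cvg _ _ (geometric B r)) => [k|k||].
  - exact: normr_ge0.
  - by rewrite /geometric /= mulr_ge0 // exprn_ge0.
  - exact: ur.
  - by apply: is_cvg_geometric_series; rewrite ger0_norm.
exists (limn (series u)) => K; apply/ler_addgt0Pr => e e0.
(* Compare with a partial sum n >= K which is e-close to the limit. *)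
move/cvgrPdist_le: cu => /(_ e e0) [N _ uN].
pose n := maxn N K; have Kn : (K <= n)%N by rewrite leq_maxr.
rewrite -(subrKA (series u n)) [X in _ <= X]addrC.
apply: le_trans (ler_normD _ _) _; apply: lerD; first exact/uN/leq_maxl.
rewrite sub_series_geq //; apply: le_trans (ler_norm_sum _ _ _) _.
apply: le_trans (ler_sum _ (fun k _ => ur k)) _.
by rewrite -mulr_sumr -mulrAC -mulrA ler_wpM2l // geometric_tail_le.
Qed.

Variable R : realType.
Implicit Types (B r q e : R[i]).

Lemma ge0_real_complex r : 0 <= r -> exists2 x : R, 0 <= x & r = x%:C.
Proof.
move=> r0; exists (complex.Re r); last by rewrite RRe_real // ger0_real.
by move: r0; rewrite lecE => /andP[].
Qed.

Lemma geometric_eventually_le B q e : 0 <= B -> 0 <= q -> q < 1 -> 0 < e ->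
  exists N, forall n, (N <= n)%N -> B * q ^+ n <= e.
Proof.
move=> /ge0_real_complex[b b0 ->] /ge0_real_complex[x x0 ->].
rewrite -(rmorph1 (real_complex R)) ltcR => x1 e0.
have /ge0_real_complex[y y0 yE] := ltW e0.
move: e0; rewrite yE -(rmorph0 (real_complex R)) ltcR => e0.
have /cvgrPdist_le/(_ _ e0)[N _ bN] : (geometric b x @ \oo --> 0)%classic.
  by apply: cvg_geometric; rewrite ger0_norm.
exists N => n Nn; have := bN n Nn; rewrite sub0r normrN ger0_norm.
  by rewrite -rmorphXn -rmorphM lecR.
by rewrite /geometric /= mulr_ge0 // exprn_ge0.
Qed.

Lemma normc_ge_Im (z : R[i]) : `|complex.Im z|%:C <= `|z|.
Proof.
by rewrite normc_def lecR -sqrtr_sqr ler_wsqrtr // lerDr sqr_ge0.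
Qed.

(** The factor 2 comes from bounding the modulus by the sum of the absolute
    values of the real and imaginary parts, each summed over the reals. *)
Lemma complex_geometric_sum (u : nat -> R[i]) B r :
  0 <= r -> r < 1 -> (forall k, `|u k| <= B * r ^+ k) ->
  exists l, forall K, `|l - series u K| <= 2 * B / (1 - r) * r ^+ K.
Proof.
move=> r0 r1 ur.
have B0 : 0 <= B by have := ur 0; rewrite expr0 mulr1; apply: le_trans.
move: B0 r0 ur r1 => /ge0_real_complex[b b0 ->] /ge0_real_complex[x x0 ->] ur.
rewrite -(rmorph1 (real_complex R)) ltcR => x1.
have part (v : nat -> R) : (forall k, `|v k|%:C <= `|u k|) ->
    exists l, forall K, `|l - series v K| <= b / (1 - x) * x ^+ K.
  move=> vu; apply: real_geometric_sum => // k.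
  by rewrite -lecR rmorphM rmorphXn; apply: le_trans (vu k) (ur k).
have [lr lrP] := part (fun k => complex.Re (u k)) (fun k => normc_ge_Re (u k)).
have [li liP] := part (fun k => complex.Im (u k)) (fun k => normc_ge_Im (u k)).
exists (lr +i* li) => K.
have -> : (lr +i* li) - series u K =
    (lr - series (fun k => complex.Re (u k)) K)%:C
    + 'i%C * (li - series (fun k => complex.Im (u k)) K)%:C.
  rewrite /series /= [\sum_(_ <= _ < _) u _](eq_bigr (fun k =>
    (complex.Re (u k))%:C + 'i%C * (complex.Im (u k))%:C)); last first.
    by move=> k _; rewrite -complexE.
  rewrite big_split /= -mulr_sumr !rmorphB !rmorph_sum /= [_ +i* _]complexE /=.
  by ring.
apply: le_trans (ler_normD _ _) _; rewrite normrM.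
have normR (t : R) : `|t%:C| = `|t|%:C.
  by rewrite normc_def /= expr0n addr0 sqrtr_sqr.
have -> : `|'i%C : R[i]| = 1 by rewrite normc_def /= expr0n expr1n add0r sqrtr1.
rewrite mul1r !normR.
have -> : 2 * b%:C / ((1 : R)%:C - x%:C) * x%:C ^+ K =
    (b / (1 - x) * x ^+ K)%:C + (b / (1 - x) * x ^+ K)%:C.
  by rewrite !rmorphM rmorphXn fmorphV !rmorphB /=; ring.
by apply: lerD; rewrite lecR.
Qed.

End GeometricBounds.

(** * Power series with coefficients of modulus at most 1 *)

Section PowerSeries.
Variable R : realType.

(** That f is the sum of the power series on the unit disk, stated with the rate
    of convergence: a bound uniform on |z| <= r is what both the recentering and
    the convergence on compact sets consume. *)
Definition power_series_sum (c : nat -> R[i]) (f : R[i] -> R[i]) : Prop :=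
  forall z r, `|z| <= r -> r < 1 ->
  forall K, `|f z - series (fun k => c k * z ^+ k) K| <= 2 / (1 - r) * r ^+ K.

Section BoundedCoefficients.
Variable c : nat -> R[i].
Hypothesis c_le1 : forall k, `|c k| <= 1.

Lemma power_series_sum_exists : exists f, power_series_sum c f.
Proof.
have sum z : exists l, `|z| < 1 -> forall K,
    `|l - series (fun k => c k * z ^+ k) K| <= 2 / (1 - `|z|) * `|z| ^+ K.
  have [z1|] := boolP (`|z| < 1); last by exists 0.
  have [k|l lP] := @complex_geometric_sum _ (fun k => c k * z ^+ k) 1 _
      (normr_ge0 z) z1.
    by rewrite normrM normrX ler_wpM2r // exprn_ge0.
  by exists l => _ K; rewrite -[X in X / _]mulr1.
have [f fP] := choice sum; exists f => z r zr r1 K.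
have z1 := le_lt_trans zr r1; have r0 := le_trans (normr_ge0 z) zr.
apply: le_trans (fP z z1 K) _; apply: ler_pM.
- by rewrite divr_ge0 // subr_ge0 ltW.
- exact: exprn_ge0.
- by rewrite ler_wpM2l // lef_pV2 ?posrE ?subr_gt0 // lerB.
- by rewrite lerXn2r ?nnegrE.
Qed.

(** With s := |z0| + rho < 1, the coefficients of the recentered series are
    d_j = sum_k c_k 'C(k, j) z0^(k - j), whose terms are at most rho^-j s^k
    because 'C(k, j) |z0|^(k - j) rho^j is one term of the expansion of s^k.
    For |w| = q rho with q < 1, cut the sum over k at K.  What remains is the
    tail of f, the tails of d_0, ..., d_(J-1), both of order s^K, and for each
    k < K a binomial remainder, at most q^J s^k by [exprD_tail_le].  Letting K
    grow with J fixed bounds the error by q^J / (1 - s). *)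
Lemma power_series_analytic (f : R[i] -> R[i]) :
  power_series_sum c f ->
  analytic_on unit_disk f.
Proof.
move=> fP z0 z0_lt1; rewrite /unit_disk /= in z0_lt1.
pose s := (1 + `|z0|) / 2; pose rho := s - `|z0|.
have s0 : 0 < s by rewrite divr_gt0 ?ltr0n // ltr_wpDr.
have s1 : s < 1 by rewrite ltr_pdivrMr ?ltr0n // mul1r -[2]/(1 + 1) ltrD2l.
have s1' : 0 < 1 - s by rewrite subr_gt0.
have rho0 : 0 < rho.
  by rewrite subr_gt0 ltr_pdivlMr ?ltr0n // mulrDr mulr1 ltrD2r.
have sE : `|z0| + rho = s by rewrite addrC subrK.
clearbody rho; clearbody s.
pose t j k := c k * (z0 ^+ (k - j) *+ 'C(k, j)).
have t_le j k : `|t j k| <= rho ^- j * s ^+ k.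
  rewrite ler_pdivlMl ?exprn_gt0 // /t normrM mulrCA.
  apply: le_trans (ler_piMl _ (c_le1 k)) _.
    by rewrite mulr_ge0 ?exprn_ge0 // ltW.
  have [kj|jk] := ltnP k j.
    by rewrite bin_small // mulr0n normr0 mulr0 exprn_ge0 // ltW.
  rewrite -sE exprDn (bigD1 (Ordinal (jk : (j < k.+1)%N))) //=.
  rewrite normrMn normrX mulrnAr [rho ^+ j * _]mulrC lerDl.
  rewrite sumr_ge0 // => i _.
  by rewrite mulrn_wge0 // mulr_ge0 ?exprn_ge0 // ltW.
have [d dP] := choice (fun j => complex_geometric_sum (ltW s0) s1 (t_le j)).
exists d; apply: filterS (nbhsx_ballx z0 rho rho0) => z z_near.
have {z_near} w_lt : `|z - z0| < rho by rewrite distrC.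
(* An abstract w, so that rewriting does not unfold it into z - z0. *)
have [w wE] : exists w, w = z - z0 by exists (z - z0).
have zE : z = z0 + w by rewrite wE addrC subrK.
rewrite -wE in w_lt *.
pose q := `|w| / rho.
have q0 : 0 <= q by rewrite divr_ge0 // ltW.
have q1 : q < 1 by rewrite ltr_pdivrMr // mul1r.
have wq : `|w| = q * rho by rewrite divfK // gt_eqF.
have zs : `|z| <= s by rewrite zE -sE (le_trans (ler_normD _ _)) // lerD2l ltW.
suff bound J : `|f z - series (fun j => d j * w ^+ j) J| <= (1 - s)^-1 * q ^+ J.
  apply/cvgrPdist_le => e e0.
  have inv0 : 0 <= (1 - s)^-1 by rewrite invr_ge0 ltW.
  have [N NP] := geometric_eventually_le inv0 q0 q1 e0.
  by exists N => // n Nn; apply: le_trans (bound n) (NP n Nn).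
apply/ler_addgt0Pr => e e0.
pose B := 2 / (1 - s) * J.+1%:R.
have B0 : 0 <= B by rewrite mulr_ge0 // divr_ge0 // ltW.
have [K /(_ K (leqnn K)) KP] := geometric_eventually_le B0 (ltW s0) s1 e0.
have -> : f z - series (fun j => d j * w ^+ j) J =
    \sum_(0 <= k < K) c k * ((z0 + w) ^+ k -
        \sum_(0 <= j < J) z0 ^+ (k - j) * w ^+ j *+ 'C(k, j))
    + ((f z - series (fun k => c k * z ^+ k) K)
       - \sum_(0 <= j < J) (d j - series (t j) K) * w ^+ j).
  (* The exchange of the two summations, on finite sums. *)
  have exch : \sum_(0 <= k < K) c k *
        (\sum_(0 <= j < J) z0 ^+ (k - j) * w ^+ j *+ 'C(k, j)) =
      \sum_(0 <= j < J) series (t j) K * w ^+ j.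
    under eq_bigr do rewrite mulr_sumr.
    rewrite exchange_big /=; apply: eq_bigr => j _.
    rewrite /series /= mulr_suml; apply: eq_bigr => k _.
    by rewrite /t -mulrA mulrnAl.
  under eq_bigr do rewrite mulrBr.
  under [X in _ + (_ - X)]eq_bigr do rewrite mulrBl.
  by rewrite !big_split /= !sumrN exch /series /= -zE; ring.
apply: le_trans (ler_normD _ _) _; apply: lerD.
  apply: le_trans (ler_norm_sum _ _ _) _.
  apply: le_trans (_ : \sum_(0 <= k < K) q ^+ J * s ^+ k <= _).
    apply: ler_sum => k _; rewrite normrM -sE.
    apply: le_trans (ler_piMl _ (c_le1 k)) _; first exact: normr_ge0.
    by apply: exprD_tail_le (ltW rho0) q0 (ltW q1); rewrite ?wq.
  rewrite -mulr_sumr mulrC ler_wpM2r ?exprn_ge0 //.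
  by have := geometric_tail_le 0 K (ltW s0) s1; rewrite expr0 div1r.
apply: le_trans KP; apply: le_trans (ler_normB _ _) _.
rewrite /B -[J.+1]add1n natrD mulrDr mulr1 mulrDl lerD //; first exact: fP.
apply: le_trans (ler_norm_sum _ _ _) _.
apply: le_trans (_ : \sum_(0 <= j < J) 2 / (1 - s) * s ^+ K <= _); last first.
  by rewrite sumr_const_nat subn0 -[leLHS]mulr_natr mulrAC.
apply: ler_sum => j _; rewrite normrM normrX.
apply: le_trans (ler_wpM2r (exprn_ge0 _ (normr_ge0 _)) (dP j K)) _.
have -> : 2 * rho ^- j / (1 - s) * s ^+ K * `|w| ^+ j =
    2 / (1 - s) * s ^+ K * q ^+ j.
  by rewrite exprMn exprVn; ring.
by rewrite ler_piMr ?exprn_ile1 ?mulr_ge0 ?exprn_ge0 ?invr_ge0 // ltW.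
Qed.

End BoundedCoefficients.

(** On |z| <= r the values f z and (p m).[z] both lie within a geometric tail of
    the partial sum of rank m, which they share.  This holds uniformly in a
    neighbourhood of each point of the disk, and compactness turns local
    uniformity into uniformity. *)
Lemma power_series_converges (c : nat -> R[i]) (f : R[i] -> R[i])
    (p : nat -> {poly R[i]}) :
  power_series_sum c f ->
  (forall m k, `|(p m)`_k| <= 1) ->
  (forall m k, (k <= m)%N -> (p m)`_k = c k) ->
  converges_on unit_disk (fun m z => (p m).[z]) f.
Proof.
move=> fP p_le1 pc.
have bound m z r : `|z| <= r -> r < 1 -> `|f z - (p m).[z]| <= 3 / (1 - r) * r ^+ m.
  move=> zr r1; have r0 := le_trans (normr_ge0 z) zr.
  have pE : (p m).[z] = series (fun k => c k * z ^+ k) m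
      + \sum_(m <= k < m + size (p m)) (p m)`_k * z ^+ k.
    rewrite (@horner_coef_wide _ (m + size (p m))) ?leq_addl //.
    rewrite -(big_mkord xpredT (fun k => (p m)`_k * z ^+ k)).
    rewrite (@big_cat_nat _ _ _ m) ?leq_addr //=; congr (_ + _).
    rewrite /series /= big_seq [RHS]big_seq; apply: eq_bigr => k.
    by rewrite mem_index_iota => /andP[_ km]; rewrite pc // ltnW.
  rewrite pE opprD addrA; apply: le_trans (ler_normB _ _) _.
  have -> : 3 = 2 + 1 :> R[i] by ring.
  rewrite [(2 + 1) / _]mulrDl [(_ + _) * r ^+ m]mulrDl lerD //; first exact: fP.
  apply: le_trans (ler_norm_sum _ _ _) _.
  apply: le_trans (_ : _ <= \sum_(m <= k < m + size (p m)) r ^+ k) _.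
    apply: ler_sum => k _; rewrite normrM normrX.
    by rewrite (le_trans (ler_piMl _ (p_le1 m k))) ?exprn_ge0 // lerXn2r ?nnegrE.
  by rewrite mul1r mulrC geometric_tail_le.
move=> K /compact_near_coveringP cK KD Q /uniform_nbhs[E [entE EQ]].
suff : \forall m \near \oo%classic, (K `<=` [set z | E (f z, (p m).[z])])%classic.
  by apply: filterS => m; apply: EQ.
apply: (cK _ _ (fun m z => E (f z, (p m).[z]))) => x Kx.
have x1 : `|x| < 1 by exact: KD.
move: entE; rewrite -entourage_ballE => -[e /= e0 eE].
pose r := (1 + `|x|) / 2.
have r0 : 0 <= r by rewrite divr_ge0 // addr_ge0.
have r1 : r < 1 by rewrite ltr_pdivrMr ?ltr0n // mul1r -[2]/(1 + 1) ltrD2l.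
have xr : 0 < r - `|x|.
  by rewrite subr_gt0 ltr_pdivlMr ?ltr0n // mulrDr mulr1 ltrD2r.
have B0 : 0 <= 3 / (1 - r) by rewrite divr_ge0 // subr_ge0 ltW.
have e2 : 0 < e / 2 by rewrite divr_gt0.
have [N NP] := geometric_eventually_le B0 r0 r1 e2.
near=> z m; apply: eE => /=.
rewrite /ball /= (le_lt_trans (bound m z r _ r1)) //.
  rewrite -(subrK x z) (le_trans (ler_normD _ _)) // -lerBrDr distrC ltW //.
  by near: z; exact: (nbhsx_ballx x _ xr).
rewrite (le_lt_trans (NP m _)) ?ltr_pdivrMr ?ltr_pMr ?ltr1n //.
by near: m; exists N.
Unshelve. all: by end_near.
Qed.

End PowerSeries.

Theorem proposition3p1 (R : realType) (b : nat -> bool) :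
  exists f : R[i] -> R[i],
    analytic_on unit_disk f /\
    forall n : nat, (0 < n)%N ->
      converges_on unit_disk
        (fun (m : nat) (z : R[i]) =>
           (stern R[i] (2 ^ m.+1 * n + \sum_(0 <= j < m.+1) 2 ^ j * b j)).[z])
        f.
Proof.
have coef_le1 n k : `|(stern R[i] n)`_k| <= 1.
  by have [[] ->] := stern_coef_bool R[i] n k; rewrite ?normr1 ?normr0.
pose c k := (stern R[i] (2 ^ k.+1 + \sum_(0 <= j < k.+1) 2 ^ j * b j))`_k.
have c_le1 k : `|c k| <= 1 by exact: coef_le1.
have [f fP] := power_series_sum_exists c_le1.
exists f; split; first exact: (power_series_analytic c_le1 fP).
move=> n n0; apply: (power_series_converges fP) => m k.
  exact: coef_le1.
by move=> km; exact: stern_coef_stable.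
Qed.
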